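(* If $A$ is a De Morgan groupoid, then its prime spectrum $\mathcal{F}_0(A)$ is a DMGrp-space.
   Context: A De Morgan algebra is a bounded distributive lattice $\langle A;\wedge,\vee,0,1\rangle$ with a unary operation $-$ such that $a\leq b$ implies $-b\leq -a$, and $--a=a$. A De Morgan groupoid is an algebra $\langle A;\wedge,\vee,-,\cdot,\rightarrow,t,0,1\rangle$ such that $\langle A;\wedge,\vee,-,0,1\rangle$ is a De Morgan algebra and, for all $a,b,c\in A$: $t\cdot a=a$; $a\cdot 0=0\cdot a=0$; $a\cdot(b\vee c)=(a\cdot b)\vee(a\cdot c)$; $(a\vee b)\cdot c=(a\cdot c)\vee(b\cdot c)$; and $a\cdot b\leq c$ iff $a\leq b\rightarrow c$. The prime spectrum of $A$ is $\mathcal{F}_0(A)=\langle\mathfrak{P}(A);g_A,S_A,\Theta_A,\tau(\beta)\rangle$, where $\mathfrak{P}(A)$ is the set of prime (in particular proper) filters of $A$; $g_A(x)=\{a\in A:-a\notin x\}$; $\Theta_A=\{x\in\mathfrak{P}(A):t\in x\}$; $S_Axyz$ iff $x\odot y\subseteq z$, where $x\odot y=\{c\in A:a\cdot b\leq c\text{ for some }a\in x,\ b\in y\}$; and $\tau(\beta)$ is the topology with basis $\{\phi(a):a\in A\}$, $\phi(a)=\{x\in\mathfrak{P}(A):a\in x\}$. For a topological space $X$, $\Omega(X)$ is the set of compact open subsets of $X$, and the specialization order is: $x\leqslant y$ iff every open set containing $x$ contains $y$. A spectral space is a compact, $T_0$, sober space $X$ such that $\Omega(X)$ is closed under finite intersections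 and is a basis for $X$ (sober: every completely prime filter of the lattice of open sets is the set of open neighbourhoods of some point). A De Morgan spectral space is $\langle X;g,\tau\rangle$ where $\langle X;\tau\rangle$ is a spectral space, $g\colon X\to X$ is an order-inverting involution for $\leqslant$, and $U^*:=\{x\in X:g(x)\notin U\}\in\Omega(X)$ for every $U\in\Omega(X)$. For $S\subseteq X^3$ and $U,V\subseteq X$ let $U\circ V=\{z\in X:\exists x,y\,(Sxyz,\ x\in U,\ y\in V)\}$ and $U\rightarrow V=\{x\in X:\forall y,z\,((Sxyz\ \text{and}\ y\in U)\Rightarrow z\in V)\}$. A DMGrp-space is $\langle X;g,S,\Theta,\tau\rangle$, with $S\subseteq X^3$ and $\Theta\subseteq X$, such that: (1) $\langle X;g,\tau\rangle$ is a De Morgan spectral space; (2) $U,V\in\Omega(X)$ implies $U\circ V\in\Omega(X)$ and $U\rightarrow V\in\Omega(X)$; (3) $Sxyz$, $x'\leqslant x$, $y'\leqslant y$, $z\leqslant z'$ imply $Sx'y'z'$; (4) if not $Sxyz$, there are $U,V\in\Omega(X)$ with $x\in U$, $y\in V$, $z\notin U\circ V$; (5) $\Theta\in\Omega(X)$ and for all $y,z$: $y\leqslant z$ iff there is $x\in\Theta$ with $Sxyz$. *)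

(* Defs.v *)
From HB Require Import structures.
From mathcomp Require Import all_boot all_order.
From mathcomp Require Import all_classical topology.

Set Implicit Arguments.
Unset Strict Implicit.
Unset Printing Implicit Defensive.

Import Order.TTheory.
Local Open Scope classical_set_scope.

HB.mixin Record TBDistrLattice_isDeMorgan d A of Order.TBDistrLattice d A := {
  dm_neg : A -> A;
  dm_neg_anti : forall a b : A, (a <= b)%O -> (dm_neg b <= dm_neg a)%O;
  dm_negK : forall a : A, dm_neg (dm_neg a) = a;
}.

#[short(type="deMorganAlgebraType")]
HB.structure Definition DeMorganAlgebra d :=
  { A of Order.TBDistrLattice d A & TBDistrLattice_isDeMorgan d A }.

(* The product is neither associative nor commutative in general, and [dm_t]
   is only a left unit. *)
HB.mixin Record DeMorganAlgebra_isGroupoid d A of DeMorganAlgebra d A := {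
  dm_mul : A -> A -> A;
  dm_imp : A -> A -> A;
  dm_t : A;
  dm_mul1l : forall a : A, dm_mul dm_t a = a;
  dm_mul0r : forall a : A, dm_mul a \bot%O = \bot%O;
  dm_mul0l : forall a : A, dm_mul \bot%O a = \bot%O;
  dm_mulUr : forall a b c : A,
    dm_mul a (b `|` c)%O = (dm_mul a b `|` dm_mul a c)%O;
  dm_mulUl : forall a b c : A,
    dm_mul (a `|` b)%O c = (dm_mul a c `|` dm_mul b c)%O;
  dm_residual : forall a b c : A,
    (dm_mul a b <= c)%O <-> (a <= dm_imp b c)%O;
}.

#[short(type="deMorganGroupoidType")]
HB.structure Definition DeMorganGroupoid d :=
  { A of DeMorganAlgebra d A & DeMorganAlgebra_isGroupoid d A }.

Section SpectralSpaces.
Context {X : topologicalType}.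
Implicit Types (F G : set (set X)) (U V : set X) (x y z : X).

Definition compact_opens : set (set X) := [set U | compact U /\ open U].

Definition spec_le x y : Prop := forall U, open U -> U x -> U y.

(* A filter of the lattice of open sets, given as a family of subsets of [X];
   taking [G] empty in [cpf_bigcup] shows that it is proper. *)
Record completely_prime_filter F : Prop := {
  cpf_open : F `<=` open;
  cpf_setT : F setT;
  cpf_up : forall U V, F U -> open V -> U `<=` V -> F V;
  cpf_setI : forall U V, F U -> F V -> F (U `&` V);
  cpf_bigcup : forall G, G `<=` open -> F (\bigcup_(U in G) U) ->
    exists2 U, G U & F U;
}.

Definition sober : Prop :=
  forall F, completely_prime_filter F -> exists x, F = open_nbhs x.

(* Closure under the empty intersection is [spectral_compact]. The empty space
   is spectral; it is the prime spectrum of the one-element algebra. *)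
Record spectral_space : Prop := {
  spectral_compact : compact [set: X];
  spectral_T0 : kolmogorov_space X;
  spectral_sober : sober;
  spectral_setI : forall U V,
    compact_opens U -> compact_opens V -> compact_opens (U `&` V);
  spectral_basis : basis compact_opens;
}.

Record DeMorgan_spectral_space (g : X -> X) : Prop := {
  dms_spectral : spectral_space;
  dms_involutive : involutive g;
  dms_anti : forall x y, spec_le x y -> spec_le (g y) (g x);
  dms_star : forall U,
    compact_opens U -> compact_opens [set x | ~ U (g x)];
}.

Definition rel_prod (S : X -> X -> X -> Prop) U V : set X :=
  [set z | exists x y, [/\ S x y z, U x & V y]].

Definition rel_imp (S : X -> X -> X -> Prop) U V : set X :=
  [set x | forall y z, S x y z /\ U y -> V z].

End SpectralSpaces.

Arguments spectral_space : clear implicits.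

Record dmgrp_frame := DMGrpFrame {
  frame_space :> topologicalType;
  frame_g : frame_space -> frame_space;
  frame_S : frame_space -> frame_space -> frame_space -> Prop;
  frame_Theta : set frame_space;
}.

Record DMGrp_space (X : dmgrp_frame) : Prop := {
  dmgrp_spectral : DeMorgan_spectral_space (@frame_g X);
  dmgrp_prod : forall U V : set X, compact_opens U -> compact_opens V ->
    compact_opens (rel_prod (@frame_S X) U V);
  dmgrp_imp : forall U V : set X, compact_opens U -> compact_opens V ->
    compact_opens (rel_imp (@frame_S X) U V);
  dmgrp_mono : forall x x' y y' z z' : X, frame_S x y z ->
    spec_le x' x -> spec_le y' y -> spec_le z z' -> frame_S x' y' z';
  dmgrp_separation : forall x y z : X, ~ frame_S x y z ->
    exists U V : set X, [/\ compact_opens U, compact_opens V, U x, V y &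
                            ~ rel_prod (@frame_S X) U V z];
  dmgrp_Theta : compact_opens (@frame_Theta X);
  dmgrp_unit : forall y z : X,
    spec_le y z <-> exists2 x, frame_Theta x & frame_S x y z;
}.

(* Given upward closure, [pf_top] is non-emptiness. *)
Record is_prime_filter d (A : tbDistrLatticeType d) (x : set A) : Prop := {
  pf_top : x \top%O;
  pf_up : forall a b : A, x a -> (a <= b)%O -> x b;
  pf_meet : forall a b : A, x a -> x b -> x (a `&` b)%O;
  pf_proper : ~ x \bot%O;
  pf_prime : forall a b : A, x (a `|` b)%O -> x a \/ x b;
}.

Record prime_filter d (A : tbDistrLatticeType d) := PrimeFilter {
  pf_set :> set A;
  pf_prime_filter : is_prime_filter pf_set;
}.

Section PrimeFilterTopology.
Context {d : Order.disp_t} {A : tbDistrLatticeType d}.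

HB.instance Definition _ := gen_eqMixin (prime_filter A).
HB.instance Definition _ := gen_choiceMixin (prime_filter A).

Lemma prime_filter_eq (x y : prime_filter A) : x = y :> set A -> x = y.
Proof.
case: x y => [x xP] [y yP] /= xy; subst y; congr PrimeFilter.
exact: Prop_irrelevance.
Qed.

Definition phi (a : A) : set (prime_filter A) := [set x | pf_set x a].

Lemma phi_cover : \bigcup_(U in range phi) U = setT.
Proof.
rewrite -subTset => x _; exists (phi \top%O); first by exists \top%O.
exact: (pf_top (pf_prime_filter x)).
Qed.

Lemma phi_meet (U V : set (prime_filter A)) x :
  range phi U -> range phi V -> U x -> V x ->
  exists W, [/\ range phi W, W x & W `<=` U `&` V].
Proof.
move=> [a _ <-] [b _ <-] xa xb; exists (phi (a `&` b)%O); split.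
- by exists (a `&` b)%O.
- exact: (pf_meet (pf_prime_filter x) xa xb).
- move=> y yab; split; apply: (pf_up (pf_prime_filter y) yab).
    exact: leIl.
  exact: leIr.
Qed.

HB.instance Definition _ :=
  isBaseTopological.Build (prime_filter A) phi_cover phi_meet.

Lemma basis_phi : basis (range phi).
Proof.
split=> [U rU|x U].
  by exists [set U]; rewrite ?bigcup_set1// => _ ->.
rewrite nbhsE => -[V [[G sG <-] [W GW Wx]] sVU].
exists W; first by split=> //; exact: sG.
by apply: subset_trans sVU => y Wy; exists W.
Qed.

End PrimeFilterTopology.

Section PrimeSpectrum.
Context {d : Order.disp_t} (A : deMorganGroupoidType d).
Implicit Types x y z : prime_filter A.

Lemma spectrum_g_subproof x : is_prime_filter [set a : A | ~ pf_set x (dm_neg a)].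
Proof.
have P := pf_prime_filter x.
have neg_top : dm_neg \top%O = \bot%O :> A.
  by apply/eqP; rewrite -lex0 -[X in (_ <= X)%O]dm_negK dm_neg_anti// lex1.
have neg_bot : dm_neg \bot%O = \top%O :> A by rewrite -neg_top dm_negK.
split=> /=.
- by rewrite neg_top; exact: (pf_proper P).
- by move=> a b xNa ab xNb; apply: xNa; exact: (pf_up P xNb (dm_neg_anti _ _ ab)).
- move=> a b xNa xNb xNab.
  suff /(pf_prime P)[] : pf_set x (dm_neg a `|` dm_neg b)%O by [].
  apply: (pf_up P xNab); rewrite -[X in (_ <= X)%O]dm_negK; apply: dm_neg_anti.
  by rewrite lexI -[X in (_ <= X)%O && _]dm_negK -[X in _ && (_ <= X)%O]dm_negK;
    rewrite !dm_neg_anti// ?leUl ?leUr.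
- by rewrite neg_bot; apply; exact: (pf_top P).
- move=> a b xNab; apply: contrapT => /not_orP[/contrapT xa /contrapT xb].
  apply: xNab; apply: (pf_up P (pf_meet P xa xb)).
  rewrite -[X in (X <= _)%O]dm_negK; apply: dm_neg_anti.
  by rewrite leUx -{1}[a]dm_negK -{2}[b]dm_negK !dm_neg_anti// ?leIl ?leIr.
Qed.

Definition spectrum_g x : prime_filter A := PrimeFilter (spectrum_g_subproof x).

Definition filter_dot (x y : set A) : set A :=
  [set c | exists a b, [/\ x a, y b & (dm_mul a b <= c)%O]].

Definition spectrum_S x y z : Prop := filter_dot x y `<=` pf_set z.

Definition spectrum_Theta : set (prime_filter A) := [set x | pf_set x dm_t].

Definition prime_spectrum : dmgrp_frame :=
  DMGrpFrame spectrum_g spectrum_S spectrum_Theta.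

End PrimeSpectrum.

(* Main.v *)
(** The engine is the prime filter theorem for distributive lattices: a filter
    disjoint from an ideal extends to a prime filter disjoint from that ideal.
    For the topology, it is applied to ideals such as
    [{b | phi b has complement in F}], for [F] a filter of sets, which shows
    that the compact open sets are exactly the sets [phi a].  For the ternary
    relation, if [F] and [G] are filters with [F . G] included in a prime
    filter [z], then [{a | a * b is not in z for some b in G}] is an ideal
    disjoint from [F], so that [F] (and then likewise [G]) can be taken prime.
    Hence [phi a o phi b = phi (a * b)] and
    [phi a -> phi b = phi (a -> b)]. *)

Require Import Defs.
From mathcomp Require Import all_boot all_order.
From mathcomp Require Import all_classical topology.

Set Implicit Arguments.
Unset Strict Implicit.
Unset Printing Implicit Defensive.

Import Order.TTheory.
Local Open Scope classical_set_scope.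

(** * Filters, ideals and the prime filter theorem *)

Record is_filter d (A : tbDistrLatticeType d) (F : set A) : Prop := {
  filter_top : F \top%O;
  filter_up : forall a b : A, F a -> (a <= b)%O -> F b;
  filter_meet : forall a b : A, F a -> F b -> F (a `&` b)%O;
}.

Record is_ideal d (A : tbDistrLatticeType d) (I : set A) : Prop := {
  ideal_bot : I \bot%O;
  ideal_down : forall a b : A, I b -> (a <= b)%O -> I a;
  ideal_join : forall a b : A, I a -> I b -> I (a `|` b)%O;
}.

Section PrimeFilterTheorem.
Context {d : Order.disp_t} {A : tbDistrLatticeType d}.
Implicit Types (F I : set A) (x y z : prime_filter A) (a b c : A).

Lemma is_filter_prime x : is_filter (pf_set x).
Proof. by case: (pf_prime_filter x). Qed.

Lemma is_filter_principal a : is_filter [set c | (a <= c)%O].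
Proof.
split=> /= [|b c ab bc|b c ab ac]; first exact: lex1.
- exact: le_trans ab bc.
- by rewrite lexI ab.
Qed.

(** Zorn gives a maximal filter [M] containing [F] and avoiding [I]. If [M] contained neither [a]
    nor [b], maximality would give [m], [n] in [M] with the meets of [m], [a] and of [n], [b] in
    [I]; by distributivity an element of [M] would then lie in [I]. *)
Lemma prime_filter_ideal_separation F I :
  is_filter F -> is_ideal I -> (forall a, F a -> ~ I a) ->
  exists2 x : prime_filter A, F `<=` pf_set x & forall a, pf_set x a -> ~ I a.
Proof.
move=> FF II FI.
(* [set0] is allowed so that the empty chain has an upper bound. *)
pose P := [set G : set A | [/\ forall a b, G a -> (a <= b)%O -> G b,
  forall a b, G a -> G b -> G (a `&` b)%O, forall a, G a -> ~ I a
  & forall a, G a -> F `<=` G]].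
have [|M [[Mup Mmeet MI MF] Mmax]] := @Zorn_bigcup _ P.
  move=> C CP Ctot; split.
  - by move=> a b [G CG Ga] ab; exists G => //; have [up _ _ _] := CP _ CG;
      exact: up ab.
  - move=> a b [G CG Ga] [H CH Hb].
    have [GH|HG] := Ctot _ _ CG CH.
      by exists H => //; have [_ meet _ _] := CP _ CH; apply: meet => //; apply: GH.
    by exists G => //; have [_ meet _ _] := CP _ CG; apply: meet => //; apply: HG.
  - by move=> a [G CG Ga]; have [_ _ GI _] := CP _ CG; exact: GI.
  - move=> a [G CG Ga] b Fb; exists G => //.
    by have [_ _ _ GF] := CP _ CG; exact: GF Ga _ Fb.
have PF : P F by case: FF => _ ? ?; split=> // a _.
(* An empty [M] would be strictly below [F], itself a member of [P]. *)
have [m0 Mm0] : exists a, M a.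
  apply: contrapT => M0; apply: (Mmax F) => //; split.
    by move=> a Ma; case: M0; exists a.
  by move=> FM; apply: M0; exists \top%O; apply: FM; exact: filter_top.
have FM : F `<=` M := MF _ Mm0.
have ext a : ~ M a -> exists2 m, M m & I (m `&` a)%O.
  move=> Ma; apply: contrapT => nI.
  (* The filter generated by [M] and [a]: if it avoided [I], it would contradict maximality. *)
  pose G := [set c | exists2 m, M m & (m `&` a <= c)%O].
  have MG : M `<=` G by move=> m Mm; exists m => //; exact: leIl.
  apply: (Mmax G).
    split=> // GM; apply: Ma; apply: GM; exists m0 => //; exact: leIr.
  split.
  - by move=> b c [m Mm mb] bc; exists m => //; exact: le_trans mb bc.
  - move=> b c [m Mm mb] [n Mn nc]; exists (m `&` n)%O; first exact: Mmeet.
    rewrite lexI; apply/andP; split; [apply: le_trans mb|apply: le_trans nc];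
      by apply: leI2 => //; rewrite ?leIl ?leIr.
  - by move=> b [m Mm mb] Ib; apply: nI; exists m => //; exact: (ideal_down II Ib mb).
  - by move=> _ _; exact: subset_trans FM MG.
suff MP : is_prime_filter M by exists (PrimeFilter MP).
split=> //.
- by apply: FM; exact: filter_top.
- by move=> /MI; apply; exact: ideal_bot.
- move=> a b Mab; apply: contrapT => /not_orP[/ext[m Mm Ima] /ext[n Mn Inb]].
  apply: (MI (m `&` n `&` (a `|` b))%O); first exact: Mmeet (Mmeet _ _ Mm Mn) Mab.
  rewrite meetUr; apply: ideal_join => //; [apply: (ideal_down II Ima)|
    apply: (ideal_down II Inb)] => //; by apply: leI2 => //; rewrite ?leIl ?leIr.
Qed.

End PrimeFilterTheorem.

(** * The spectral topology on prime filters *)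

Section PrimeFilterSpace.
Context {d : Order.disp_t} {A : tbDistrLatticeType d}.
Implicit Types (x y z : prime_filter A) (a b c : A) (U : set (prime_filter A)).

Lemma phi0 : phi (\bot%O : A) = set0.
Proof. by rewrite -subset0 => x; exact: (pf_proper (pf_prime_filter x)). Qed.

Lemma phiT : phi (\top%O : A) = setT.
Proof. by rewrite -subTset => x _; exact: (pf_top (pf_prime_filter x)). Qed.

Lemma phiI a b : phi (a `&` b)%O = phi a `&` phi b.
Proof.
apply/seteqP; split=> x /=; last by case; exact: (pf_meet (pf_prime_filter x)).
by move=> xab; split; apply: (pf_up (pf_prime_filter x) xab);
  [exact: leIl|exact: leIr].
Qed.

Lemma phiU a b : phi (a `|` b)%O = phi a `|` phi b.
Proof.
apply/seteqP; split=> x /=; first exact: (pf_prime (pf_prime_filter x)).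
by case=> xa; apply: (pf_up (pf_prime_filter x) xa); [exact: leUl|exact: leUr].
Qed.

Lemma phi_sub a b : (a <= b)%O -> phi a `<=` phi b.
Proof. by move=> ab x xa; exact: (pf_up (pf_prime_filter x) xa). Qed.

Lemma open_phi a : open (phi a).
Proof. by apply: (proj1 basis_phi); exists a. Qed.

Lemma open_phi_nbhd U x : open U -> U x -> exists2 a, phi a x & phi a `<=` U.
Proof.
move=> oU Ux; have [_ /(_ x U)] := @basis_phi _ A.
by case=> [|_ [[a _ <-] xa] aU]; [exact: open_nbhs_nbhs|exists a].
Qed.

(* If no point of [phi a] were a cluster point of [F], every prime filter
   containing [a] would meet the ideal of those [b] with [~` phi b] in [F]. *)
Lemma compact_phi a : compact (phi a).
Proof.
move=> F PF Fa.
pose I := [set b : A | F (~` phi b)].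
have II : is_ideal I.
  split; rewrite /I /=.
  - by rewrite phi0 setC0; exact: filterT.
  - by move=> b c Fc bc; apply: filterS Fc; apply: subsetC; exact: phi_sub.
  - by move=> b c Fb Fc; rewrite phiU setCU; exact: filterI.
have [|x ax xI] := prime_filter_ideal_separation (is_filter_principal a) II.
  move=> b /= ab Ib; apply: (filter_not_empty F).
  apply: filterS (filterI Fa Ib) => y [ya]; apply.
  exact: phi_sub ya.
exists x; split; first exact: ax (lexx a).
move=> B N FB; rewrite nbhsE => -[U [oU Ux] UN].
have [b xb bU] := open_phi_nbhd oU Ux.
apply: contrapT => BN; apply: (xI b) => //; rewrite /I /=.
apply: filterS FB => y By yb; apply: BN; exists y; split=> //.
exact/UN/bU.
Qed.

(** Otherwise the sets [U]\[phi a], for [phi a] included in [U], are nonempty and generate a proper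
    filter, as these [a] form an ideal. A cluster point in [U] would lie in such a [phi a], which is
    disjoint from a member of the filter. *)
Lemma compact_open_phi U : compact U -> open U -> exists a, U = phi a.
Proof.
move=> cU oU; apply: contrapT => nU.
pose I := [set a : A | phi a `<=` U].
have UI a : I a -> (U `\` phi a) !=set0.
  move=> aU; apply/set0P/eqP; rewrite setD_eq0 => Ua; apply: nU; exists a.
  by apply/seteqP; split.
pose F := [set B | exists2 a, I a & U `\` phi a `<=` B].
have PF : ProperFilter F.
  split.
    by case=> a /UI[x Ux] /(_ _ Ux).
  split.
  - by exists \bot%O => //; rewrite /I /= phi0.
  - move=> B C [a aU aB] [b bU bC]; exists (a `|` b)%O.
      by rewrite /I /= phiU => x [/aU|/bU].
    by rewrite phiU => x [Ux /not_orP[xa xb]]; split; [apply: aB|apply: bC].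
  - by move=> B C BC [a aU aB]; exists a => //; exact: subset_trans BC.
have [x [Ux clx]] : U `&` cluster F !=set0.
  by apply: cU; exists \bot%O => [|y []//]; rewrite /I /= phi0.
have [a xa aU] := open_phi_nbhd oU Ux.
have [|y [[_ ya] //]] := clx (U `\` phi a) (phi a) _
  (open_nbhs_nbhs (conj (open_phi a) xa)).
by exists a.
Qed.

Lemma compact_opensE : compact_opens = range (@phi _ A).
Proof.
apply/seteqP; split=> [U [cU oU]|_ [a _ <-]].
  by have [a ->] := compact_open_phi cU oU; exists a.
by split; [exact: compact_phi|exact: open_phi].
Qed.

Lemma compact_opens_phi a : compact_opens (phi a).
Proof. by rewrite compact_opensE; exists a. Qed.

Lemma spec_le_subset x y : spec_le x y <-> pf_set x `<=` pf_set y.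
Proof.
split=> [xy a xa|xy U oU Ux]; first exact: (xy _ (open_phi a)).
by have [a xa] := open_phi_nbhd oU Ux; apply; exact: xy.
Qed.

Lemma kolmogorov_prime_filter : kolmogorov_space (prime_filter A).
Proof.
have sep x y : ~ (pf_set x `<=` pf_set y) ->
    exists B, B \in nbhs x /\ y \in ~` B.
  move=> /existsNP[a /not_implyP[xa ya]]; exists (phi a); rewrite !inE.
  by split=> //; apply: open_nbhs_nbhs; split; first exact: open_phi.
move=> x y /eqP xy.
have [xsy|/sep[B ?]] := pselect (pf_set x `<=` pf_set y); last by exists B; left.
have [ysx|/sep[B ?]] := pselect (pf_set y `<=` pf_set x); last by exists B; right.
by case: xy; apply: prime_filter_eq; apply/seteqP; split.
Qed.

(** The point is the set of [a] with [phi a] in [F]. Complete primeness is used three times: on the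
    empty family for properness, on pairs for primeness, and on the basic sets inside [U] to recover
    [F] from the point. *)
Lemma sober_prime_filter : @sober (prime_filter A).
Proof.
move=> F [Fopen FT Fup FI Fcup].
have xP : is_prime_filter [set a : A | F (phi a)].
  split=> /=.
  - by rewrite phiT.
  - by move=> a b Fa ab; apply: Fup Fa _ _; [exact: open_phi|exact: phi_sub].
  - by move=> a b Fa Fb; rewrite phiI; exact: FI.
  - rewrite phi0 => F0; have [||U []] := Fcup set0; first exact: sub0set.
    by rewrite bigcup_set0.
  - move=> a b; rewrite phiU -bigcup2E => Fab.
    have [||U] := Fcup [set phi a; phi b].
    + by move=> _ [] ->; exact: open_phi.
    + by rewrite bigcup_setU !bigcup_set1 -bigcup2E.
    + by case=> ->; [left|right].
exists (PrimeFilter xP); apply/seteqP; split=> U.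
  move=> FU; have oU := Fopen _ FU; split=> //.
  have [||_ [a aU <-] Fa] := Fcup (phi @` [set a | phi a `<=` U]).
  - by move=> _ [a _ <-]; exact: open_phi.
  - apply: Fup FU _ _.
      by apply: bigcup_open => _ [a _ <-]; exact: open_phi.
    move=> y Uy; have [a ya aU] := open_phi_nbhd oU Uy.
    by exists (phi a) => //; exists a.
  - exact: aU.
case=> oU /(open_phi_nbhd oU)[a Fa aU].
exact: Fup Fa oU aU.
Qed.

Lemma spectral_prime_filter : spectral_space (prime_filter A).
Proof.
split.
- by rewrite -phiT; exact: compact_phi.
- exact: kolmogorov_prime_filter.
- exact: sober_prime_filter.
- rewrite compact_opensE => _ _ [a _ <-] [b _ <-].
  by rewrite -phiI; exists (a `&` b)%O.
- by rewrite compact_opensE; exact: basis_phi.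
Qed.

End PrimeFilterSpace.

(** * The involution and the ternary relation in terms of [phi] *)

Section PrimeSpectrum.
Context {d : Order.disp_t} {A : deMorganGroupoidType d}.
Implicit Types (F G : set A) (x y z : prime_filter A) (a b c : A).

Lemma spectrum_gK : involutive (@spectrum_g d A).
Proof.
move=> x; apply: prime_filter_eq; apply/seteqP; split=> a /=; rewrite dm_negK.
  exact: contrapT.
by move=> xa; apply.
Qed.

Lemma DeMorgan_spectral_spectrum : DeMorgan_spectral_space (@spectrum_g d A).
Proof.
split.
- exact: spectral_prime_filter.
- exact: spectrum_gK.
- by move=> x y /spec_le_subset xy; apply/spec_le_subset => a ya /xy.
(* Membership of [a] in [spectrum_g x] is already a negation, so the star of [phi a] is
   [phi (dm_neg a)] up to double negation. *)
- rewrite compact_opensE => _ [a _ <-]; exists (dm_neg a) => //.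
  by apply/seteqP; split=> x /=; [move=> xa; apply|exact: contrapT].
Qed.

Lemma dm_mul_le a a' b b' :
  (a <= a')%O -> (b <= b')%O -> (dm_mul a b <= dm_mul a' b')%O.
Proof.
move=> aa' bb'; apply: (@le_trans _ _ (dm_mul a' b)).
  by rewrite -(join_r aa') dm_mulUl leUl.
by rewrite -(join_r bb') dm_mulUr leUl.
Qed.

Lemma filter_dotE F G z : filter_dot F G `<=` pf_set z <->
  forall a b, F a -> G b -> pf_set z (dm_mul a b).
Proof.
split=> [Fz a b Fa Gb|Fz c [a [b [Fa Gb abc]]]]; first by apply: Fz; exists a, b.
exact: (pf_up (pf_prime_filter z) (Fz _ _ Fa Gb)).
Qed.

Lemma is_filter_dot F G : is_filter F -> is_filter G -> is_filter (filter_dot F G).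
Proof.
move=> FF FG; split.
- by exists \top%O, \top%O; split; [exact: filter_top|exact: filter_top|exact: lex1].
- by move=> c e [a [b [Fa Gb abc]]] ce; exists a, b; split=> //; exact: le_trans ce.
- move=> c e [a [b [Fa Gb abc]]] [a' [b' [Fa' Gb' abe]]].
  exists (a `&` a')%O, (b `&` b')%O; split; [exact: filter_meet..|].
  by rewrite lexI (le_trans _ abc) ?(le_trans _ abe)// dm_mul_le ?leIl ?leIr.
Qed.

Lemma filter_dot_prime_left F G z : is_filter F -> is_filter G ->
  filter_dot F G `<=` pf_set z ->
  exists2 x, F `<=` pf_set x & filter_dot (pf_set x) G `<=` pf_set z.
Proof.
move=> FF FG /filter_dotE FGz; have zP := pf_prime_filter z.
pose I := [set a | exists2 b, G b & ~ pf_set z (dm_mul a b)].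
have II : is_ideal I.
  split.
  - exists \top%O; first exact: filter_top.
    by rewrite dm_mul0l; exact: (pf_proper zP).
  - move=> a a' [b Gb nz] aa'; exists b => // /(pf_up zP) zab.
    by apply/nz/zab/dm_mul_le.
  (* The meet serves as a common witness in [G]; primeness of [z] then splits the product of the
     join. *)
  - move=> a a' [b Gb nz] [b' Gb' nz']; exists (b `&` b')%O.
      exact: filter_meet.
    rewrite dm_mulUl => /(pf_prime zP)[] /(pf_up zP) zab; [apply: nz|apply: nz'];
      by apply: zab; apply: dm_mul_le; rewrite ?leIl ?leIr.
have [a Fa [b Gb]|x Fx xI] := prime_filter_ideal_separation FF II.
  by apply; exact: FGz.
exists x => //; apply/filter_dotE => a b xa Gb.
by apply: contrapT => nz; apply: (xI a) => //; exists b.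
Qed.

(** Mirror image of [filter_dot_prime_left], resting on [dm_mul0r] and [dm_mulUr] since the product
    need not commute. *)
Lemma filter_dot_prime_right F G z : is_filter F -> is_filter G ->
  filter_dot F G `<=` pf_set z ->
  exists2 y, G `<=` pf_set y & filter_dot F (pf_set y) `<=` pf_set z.
Proof.
move=> FF FG /filter_dotE FGz; have zP := pf_prime_filter z.
pose I := [set b | exists2 a, F a & ~ pf_set z (dm_mul a b)].
have II : is_ideal I.
  split.
  - exists \top%O; first exact: filter_top.
    by rewrite dm_mul0r; exact: (pf_proper zP).
  - move=> b b' [a Fa nz] bb'; exists a => // /(pf_up zP) zab.
    by apply/nz/zab/dm_mul_le.
  - move=> b b' [a Fa nz] [a' Fa' nz']; exists (a `&` a')%O.
      exact: filter_meet.
    rewrite dm_mulUr => /(pf_prime zP)[] /(pf_up zP) zab; [apply: nz|apply: nz'];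
      by apply: zab; apply: dm_mul_le; rewrite ?leIl ?leIr.
have [b Gb [a Fa]|y Gy yI] := prime_filter_ideal_separation FG II.
  by apply; exact: FGz.
exists y => //; apply/filter_dotE => a b Fa yb.
by apply: contrapT => nz; apply: (yI b) => //; exists a.
Qed.

Lemma rel_prod_phi a b :
  rel_prod (@spectrum_S d A) (phi a) (phi b) = phi (dm_mul a b).
Proof.
apply/seteqP; split=> z.
  by case=> x [y [/filter_dotE xyz xa yb]]; exact: xyz.
move=> zab.
have Fa := is_filter_principal a; have Fb := is_filter_principal b.
(* The principal filters of [a] and [b] are made prime one after the other, so that the second
   extension respects the first. *)
have [|x ax xbz] := filter_dot_prime_left (z := z) Fa Fb.
  apply/filter_dotE => a' b' /= aa' bb'.
  exact: (pf_up (pf_prime_filter z) zab (dm_mul_le aa' bb')).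
have [y bY xyz] := filter_dot_prime_right (is_filter_prime x) Fb xbz.
by exists x, y; split=> //; [exact: ax (lexx a)|exact: bY (lexx b)].
Qed.

Lemma rel_imp_phi a b :
  rel_imp (@spectrum_S d A) (phi a) (phi b) = phi (dm_imp a b).
Proof.
apply/seteqP; split=> x.
  move=> xab; apply: contrapT => xNab.
  have Fx := is_filter_prime x; have Fa := is_filter_principal a.
  have Ib : is_ideal [set c | (c <= b)%O].
    split=> /= [|c e cb ec|c e cb eb]; first exact: le0x.
    - exact: le_trans cb.
    - by rewrite leUx cb.
  (* By residuation, a product of an element of [x] with one above [a] can lie below [b] only if
     [dm_imp a b] is in [x]. So a prime [z] omitting [b] exists, and the principal filter of [a]
     then extends to the required [y]. *)
  have [c|z xaz zb] := prime_filter_ideal_separation (is_filter_dot Fx Fa) Ib.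
    case=> e [a' [/= xe aa' ea'c]] cb; apply: xNab.
    apply: (pf_up (pf_prime_filter x) xe); apply/dm_residual.
    by apply: le_trans (le_trans ea'c cb); exact: dm_mul_le.
  have [y ay xyz] := filter_dot_prime_right Fx Fa xaz.
  apply: (zb b) => //=; apply: (xab y); split=> //; exact: ay (lexx a).
move=> xab y z [/filter_dotE xyz ya].
apply: (pf_up (pf_prime_filter z) (xyz _ _ xab ya)).
exact/dm_residual.
Qed.

(** The left unit law makes the product of the principal filter of [dm_t] with [y] stay inside [y],
    hence inside [z]; extending that principal filter to a prime one gives [x]. *)
Lemma spectrum_Theta_unit y z :
  pf_set y `<=` pf_set z <-> exists2 x, spectrum_Theta x & spectrum_S x y z.
Proof.
split=> [yz|[x xt /filter_dotE xyz] b yb]; last first.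
  by rewrite -(dm_mul1l b); exact: xyz.
have [|x tx xyz] := filter_dot_prime_left (z := z)
  (is_filter_principal (dm_t : A)) (is_filter_prime y).
  apply/filter_dotE => a b /= ta yb.
  apply: (pf_up (pf_prime_filter z) (yz _ yb)).
  by rewrite -{1}(dm_mul1l b); exact: dm_mul_le.
by exists x => //; exact: tx (lexx _).
Qed.

End PrimeSpectrum.

Theorem lemma4p7 (d : Order.disp_t) (A : deMorganGroupoidType d) :
  DMGrp_space (prime_spectrum A).
Proof.
split=> /=.
- exact: DeMorgan_spectral_spectrum.
- rewrite compact_opensE => _ _ [a _ <-] [b _ <-].
  by rewrite rel_prod_phi; exists (dm_mul a b).
- rewrite compact_opensE => _ _ [a _ <-] [b _ <-].
  by rewrite rel_imp_phi; exists (dm_imp a b).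
- move=> x x' y y' z z' /filter_dotE xyz /spec_le_subset x'x /spec_le_subset y'y.
  move=> /spec_le_subset zz'; apply/filter_dotE => a b x'a y'b.
  by apply/zz'/xyz; [exact: x'x|exact: y'y].
(* The factors [a], [b] behind an element [c] missing from [z] give the separating sets:
   [dm_mul a b] lies below [c], so it is missing too. *)
- move=> x y z /existsNP[c /not_implyP[[a [b [xa yb abc]]] zc]].
  exists (phi a), (phi b); split=> //; [exact: compact_opens_phi..|].
  by rewrite rel_prod_phi => /(pf_up (pf_prime_filter z))/(_ abc).
- exact: (compact_opens_phi dm_t).
- by move=> y z; rewrite -spectrum_Theta_unit; exact: spec_le_subset.
Qed.
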